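(* Let $|||\cdot|||$ be a symmetric norm on $\mathcal{M}_n$ and let $A,B\in\mathcal{M}_n$ with $B$ invertible. Then for all $r,p>0$ and $q<0$ with $\frac1r=\frac1p+\frac1q$, $$|||\,|AB|^r\,|||^{\frac1r}\ \ge\ |||\,|A|^p\,|||^{\frac1p}\cdot|||\,|B|^q\,|||^{\frac1q}.$$
   Context: $\mathcal{M}_n$ is the set of $n\times n$ (complex) matrices; $|X|=(X^*X)^{1/2}$, with powers taken by functional calculus. A symmetric gauge function is a norm $\Phi$ on $\mathbb{R}^n$, invariant under permutations of coordinates and under sign changes of coordinates, with $\Phi(1,0,\ldots,0)=1$. A symmetric norm on $\mathcal{M}_n$ is a norm of the form $|||A|||=\Phi(s(A))$, where $\Phi$ is a symmetric gauge function and $s(A)=(s_1(A),\ldots,s_n(A))$ is the vector of singular values of $A$ in decreasing order. *)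

(* Defs.v *)
From mathcomp Require Export all_boot all_order all_fingroup all_algebra.
From mathcomp Require Export complex.
From mathcomp Require Export boolp reals exp.

Set Implicit Arguments.
Unset Strict Implicit.
Unset Printing Implicit Defensive.

Import Order.TTheory GRing.Theory Num.Theory.

Local Open Scope ring_scope.
Local Open Scope sesquilinear_scope.

(* Real-valued norms on a K-module.  The absolute value [abs] of the scalars is
   a parameter because the one of R[i] takes its values in R[i], not in R. *)
Definition is_norm (R : realType) (K : nzRingType) (abs : K -> R)
    (V : lmodType K) (N : V -> R) : Prop :=
  [/\ forall x, 0 <= N x,
      forall x, N x = 0 -> x = 0,
      forall a x, N (a *: x) = abs a * N x &
      forall x y, N (x + y) <= N x + N y].

Definition symmetric_gauge (R : realType) (n : nat) (Phi : 'rV[R]_n -> R) : Prop :=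
  [/\ is_norm Num.norm Phi,
      forall (s : 'S_n) (x : 'rV[R]_n), Phi (col_perm s x) = Phi x,
      forall (e : 'I_n -> bool) (x : 'rV[R]_n),
        Phi (\row_i ((-1) ^+ e i * x 0 i)) = Phi x &
      forall i : 'I_n, i = 0%N :> nat -> Phi (delta_mx 0 i) = 1].

(* f(H) for a Hermitian matrix H: the entries of [spectral_diag H] are then
   real, so that taking their real parts loses nothing. *)
Definition mxfun (R : realType) (n : nat) (f : R -> R) (H : 'M[R[i]]_n)
    : 'M[R[i]]_n :=
  invmx (spectralmx H)
    *m diag_mx (map_mx (fun z => (f (complex.Re z))%:C%C) (spectral_diag H))
    *m spectralmx H.

Definition absmx (R : realType) (n : nat) (X : 'M[R[i]]_n) : 'M[R[i]]_n :=
  mxfun Num.sqrt (X ^t* *m X).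

(* [powR 0 t] is 0 for every t != 0, so that |X|^t is the usual power as soon
   as t > 0, or X is invertible. *)
Definition absmx_pow (R : realType) (n : nat) (X : 'M[R[i]]_n) (t : R)
    : 'M[R[i]]_n :=
  mxfun (fun a => powR a t) (absmx X).

(* The singular values are the eigenvalues of |X|, with multiplicities. *)
Definition singular_values (R : realType) (n : nat) (X : 'M[R[i]]_n) : 'rV[R]_n :=
  \row_i nth 0 (sort >=%R [seq complex.Re (spectral_diag (absmx X) 0 j)
                             | j <- enum 'I_n]) i.

Definition symmetric_norm (R : realType) (n : nat) (N : 'M[R[i]]_n -> R) : Prop :=
  is_norm (@ComplexField.Normc.normc R) N /\
  exists2 Phi : 'rV[R]_n -> R, symmetric_gauge Phi &
    forall X, N X = Phi (singular_values X).

(* Main.v *)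
(* Put X = A B and Y = B^-1, so that A = X Y.  The claim is Hoelder's inequality
   || |XY|^p ||^(1/p) <= || |X|^r ||^(1/r) || |Y|^(-q) ||^(-1/q), the singular
   values of Y being the inverses of those of B.  By Cauchy-Binet, compressing
   a positive matrix H to k vectors multiplies their Gram determinant by at most
   the product of the k largest eigenvalues of H; this gives Horn's inequality
   s_1(XY)...s_k(XY) <= s_1(X)s_1(Y)...s_k(X)s_k(Y).  Such log-majorization
   survives the p-th power and implies weak majorization, under which a
   symmetric gauge function is monotone; Young's inequality concludes. *)
Require Import Defs.
From mathcomp Require Import ring lra.

Set Implicit Arguments.
Unset Strict Implicit.
Unset Printing Implicit Defensive.

Import Order.TTheory GRing.Theory Num.Theory.
Local Open Scope ring_scope.
Local Open Scope sesquilinear_scope.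

(** * Symmetric gauge functions and majorization *)

Section Gauge.
Variables (R : realType) (n : nat) (Phi : 'rV[R]_n -> R).
Hypothesis gPhi : symmetric_gauge Phi.

Lemma gauge_ge0 x : 0 <= Phi x.
Proof. by case: gPhi => -[]. Qed.

Lemma gauge0_eq0 x : Phi x = 0 -> x = 0.
Proof. by case: gPhi => -[_ h _ _ _ _ _]; apply: h. Qed.

Lemma gaugeZ a x : Phi (a *: x) = `|a| * Phi x.
Proof. by case: gPhi => -[]. Qed.

Lemma gauge_perm (s : 'S_n) x : Phi (col_perm s x) = Phi x.
Proof. by case: gPhi. Qed.

Lemma gauge_convex t c u v : 0 <= t <= 1 -> Phi u <= c -> Phi v <= c ->
  Phi (t *: u + (1 - t) *: v) <= c.
Proof.
case: gPhi => -[_ _ _ ler_gaugeD] _ _ _ /andP[t0 t1] uc vc.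
apply: le_trans (ler_gaugeD _ _) _; rewrite !gaugeZ !ger0_norm ?subr_ge0//.
by nra.
Qed.

(** Writing [x 0 j] as a convex combination of [y 0 j] and [- y 0 j] makes [x] one of [y] and of [y]
    with its [j]-th sign flipped, and these two have the same gauge. *)
Lemma gauge_coord (x y : 'rV[R]_n) (j : 'I_n) : (forall i, i != j -> x 0 i = y 0 i) ->
  `|x 0 j| <= y 0 j -> Phi x <= Phi y.
Proof.
move=> exy; have [y0|ypos] := lerP (y 0 j) 0.
  move=> xy; suff -> : x = y by [].
  have yj0 : y 0 j = 0 by apply/eqP; rewrite eq_le y0 (le_trans _ xy).
  apply/rowP => i; have [->|/exy//] := eqVneq i j.
  by apply/eqP; rewrite yj0 -normr_le0 -yj0.
rewrite ler_norml => /andP[xl xu].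
pose y' : 'rV[R]_n := \row_i ((-1) ^+ (i == j) * y 0 i).
pose t := (1 + x 0 j / y 0 j) / 2.
have -> : x = t *: y + (1 - t) *: y'.
  apply/rowP => i; rewrite !mxE; have [->|ij] := eqVneq i j.
    by rewrite expr1 /t; field; lra.
  by rewrite expr0 exy//; ring.
have : -1 <= x 0 j / y 0 j <= 1.
  by rewrite ler_pdivlMr// ler_pdivrMr// mulN1r mul1r xl.
rewrite /t => ?; apply: gauge_convex => //; first lra.
by case: gPhi => _ _ h _; rewrite h.
Qed.

Lemma gauge_mono (x y : 'rV[R]_n) : (forall i, 0 <= x 0 i <= y 0 i) -> Phi x <= Phi y.
Proof.
move=> xy.
(* [z k] takes its first [k] coordinates from [x], so consecutive rows differ in at most one
   coordinate. *)
pose z (k : nat) : 'rV[R]_n := \row_i if (i < k)%N then x 0 i else y 0 i.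
have zy k : Phi (z k) <= Phi y.
  elim: k => [|k IHk].
    by suff -> : z 0 = y by []; apply/rowP => i; rewrite mxE.
  apply: le_trans IHk; have [kn|nk] := ltnP k n.
    apply: (@gauge_coord _ _ (Ordinal kn)).
      by move=> i; rewrite !mxE -val_eqE/= ltnS leq_eqVlt => /negPf ->.
    by rewrite !mxE ltnS leqnn ltnn /=; case/andP: (xy (Ordinal kn)) => *; rewrite ger0_norm.
  suff -> : z k.+1 = z k by [].
  by apply/rowP => i; rewrite !mxE !(leq_trans (ltn_ord i))// ltnW.
suff <- : z n = x by [].
by apply/rowP => i; rewrite !mxE ltn_ord.
Qed.

(** When [d] is nonzero, [x] is a convex combination of [y] and of [y] with coordinates [i] and [j]
    exchanged, the exchanged row having weight [d / (y 0 i - y 0 j)]. *)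
Lemma gauge_transfer (x y : 'rV[R]_n) (i j : 'I_n) (d : R) : i != j ->
  (forall k, x 0 k = y 0 k - d * (k == i)%:R + d * (k == j)%:R) ->
  0 <= d <= y 0 i - y 0 j -> Phi x <= Phi y.
Proof.
move=> ij ex /andP[d0 dij]; have [yij|yij] := lerP (y 0 i) (y 0 j).
  suff -> : x = y by [].
  have d00 : d = 0 by lra.
  by apply/rowP => k; rewrite ex d00 !mul0r subr0 addr0.
pose t := 1 - d / (y 0 i - y 0 j).
have -> : x = t *: y + (1 - t) *: col_perm (tperm i j) y.
  apply/rowP => k; rewrite !mxE ex /t; case: tpermP => [->|->|].
  - by rewrite eqxx (negPf ij) /=; field; lra.
  - by rewrite eqxx eq_sym (negPf ij) /=; field; lra.
  by move=> /eqP/negPf-> /eqP/negPf->; field; lra.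
have : 0 <= d / (y 0 i - y 0 j) <= 1.
  by rewrite divr_ge0 ?subr_ge0 ?(ltW yij)//= ler_pdivrMr ?subr_gt0// mul1r.
by rewrite /t => ?; apply: gauge_convex; rewrite ?gauge_perm//; lra.
Qed.

(* Ky Fan dominance.  Each step moves mass of b from an early index, where b
   exceeds a, to a later one, where a exceeds b, until a <= b. *)
Lemma gauge_wmaj (a b : nat -> R) :
  (forall i j, (i <= j < n)%N -> a j <= a i) -> (forall i, 0 <= a i) ->
  (forall k, (k <= n)%N -> \sum_(l < k) a l <= \sum_(l < k) b l) ->
  Phi (\row_(i < n) a i) <= Phi (\row_(i < n) b i).
Proof.
move=> adec a0.
(* Induction on the number of indices where [a] and [b] differ. *)
have [m] := ubnP #|[pred l : 'I_n | a l != b l]|.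
elim: m b => // m IHm b; rewrite ltnS => cm sab.
have [/existsP[j0 hj0]|] := boolP [exists j : 'I_n, b j < a j]; last first.
  rewrite negb_exists => /forallP ab; apply: gauge_mono => i.
  by rewrite !mxE a0 leNgt ab.
have exj : exists j, (j < n)%N && (b j < a j) by exists j0; rewrite ltn_ord.
case: (ex_minnP exj) => j /andP[jn baj] jmin {exj j0 hj0}.
have ltj l : (l < j)%N -> a l <= b l.
  move=> lj; rewrite leNgt; apply/negP => bal.
  by have := jmin l; rewrite bal (ltn_trans lj)// leqNgt lj => /(_ isT).
(* Were [b] at most [a] everywhere below [j], the partial sums through [j] would contradict
   [sab]. *)
have [i abi] : exists i : 'I_j, a i < b i.
  apply/existsP; apply: contraT; rewrite negb_exists => /forallP nab.
  have := sab j.+1 jn; rewrite !big_ord_recr/= leNgt ler_ltD//.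
  by apply: ler_sum => l _; rewrite leNgt nab.
have ij := ltn_ord i; have iNj := ltn_eqF ij.
(* With this minimum [b] meets [a] at [i] or at [j], so one disagreement disappears, and neither
   coordinate crosses [a]. *)
pose d := Num.min (b i - a i) (a j - b j).
have aji : a j <= a i by rewrite adec// ltnW.
have d0 : 0 <= d by rewrite le_min; lra.
have d1 : d <= b i - a i by rewrite ge_min lexx.
have d2 : d <= a j - b j by rewrite ge_min lexx orbT.
pose b' l := b l - d * (l == i :> nat)%:R + d * (l == j)%:R.
have sum_delta k h : \sum_(l < k) d * (l == h :> nat)%:R = d * (h < k)%:R.
  rewrite -mulr_sumr; congr (_ * _); case: ltnP => [hk|kh].
    rewrite (bigD1 (Ordinal hk))//= eqxx big1 ?addr0// => l.
    by rewrite -val_eqE/= => /negPf->.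
  by rewrite big1// => l _; rewrite ltn_eqF// (leq_trans (ltn_ord l)).
pose oi : 'I_n := Ordinal (ltn_trans ij jn); pose oj : 'I_n := Ordinal jn.
have b'i : b' i = b i - d by rewrite /b' eqxx iNj mulr1 mulr0 addr0.
have b'j : b' j = b j + d by rewrite /b' eqxx eq_sym iNj mulr1 mulr0 subr0.
have b'l (l : nat) : l != i -> l != j -> b' l = b l.
  by move=> /negPf li /negPf lj; rewrite /b' li lj !mulr0 subr0 addr0.
apply: (@le_trans _ _ (Phi (\row_(i < n) b' i))).
  apply: IHm => [|k kn].
    apply: leq_trans cm; apply: proper_card; apply/properP; split.
      apply/subsetP => l; rewrite !inE; apply: contra => /eqP al.
      have [li|li] := eqVneq (l : nat) i; first by move: al; rewrite li; lra.
      have [lj|lj] := eqVneq (l : nat) j; first by move: al; rewrite lj; lra.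
      by rewrite b'l// al.
    have [dd|dd] := lerP (b i - a i) (a j - b j).
      have e : a i = b' i by rewrite b'i /d (min_idPl dd); ring.
      by exists oi; rewrite !inE ?negbK; [rewrite lt_eqF | apply/eqP].
    have e : a j = b' j by rewrite b'j /d (min_idPr (ltW dd)); ring.
    by exists oj; rewrite !inE ?negbK; [rewrite gt_eqF | apply/eqP].
  (* For [k <= j] the terms of [b'] still dominate those of [a]; for [k > j] the sum contains both
     ends of the transfer, which cancel. *)
  have [kj|jk] := leqP k j.
    apply: ler_sum => l _; have lj := leq_trans (ltn_ord l) kj.
    have [li|li] := eqVneq (l : nat) i; first by rewrite li b'i; lra.
    by rewrite b'l ?ltj// ltn_eqF.
  rewrite big_split sumrB !sum_delta jk (ltn_trans ij jk) /= subrK.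
  exact: sab.
apply: (@gauge_transfer _ _ oi oj d); first by rewrite -val_eqE/= iNj.
  by move=> k; rewrite !mxE.
by rewrite !mxE /=; lra.
Qed.

End Gauge.

Lemma abel_ge0 (R : realType) (c w : nat -> R) (k : nat) :
  (forall i, (i < k)%N -> 0 <= c i) ->
  (forall i, (i.+1 < k)%N -> c i.+1 <= c i) ->
  (forall m, (m <= k)%N -> 0 <= \sum_(i < m) w i) ->
  0 <= \sum_(i < k) c i * w i.
Proof.
move=> c0 cdec w0; case: k => [|k] in c0 cdec w0 *; first by rewrite big_ord0.
(* The induction runs on this stronger bound: as the partial sums of [w] are nonnegative, replacing
   [c m] by the smaller [c m.+1] only lowers the left side. *)
suff h m : (m <= k)%N -> c m * \sum_(i < m.+1) w i <= \sum_(i < m.+1) c i * w i.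
  by apply: le_trans (h k _) => //; rewrite mulr_ge0 ?c0 ?w0.
elim: m => [|m IHm] mk; first by rewrite !big_ord_recl !big_ord0 !addr0.
rewrite big_ord_recr [leRHS]big_ord_recr/= mulrDr lerD2r.
apply: le_trans (IHm (ltnW mk)); apply: ler_wpM2r; first by rewrite w0// ltnW.
exact: cdec.
Qed.

(* By Abel summation, from the tangent bound b - a >= a ln (b / a). *)
Lemma log_wmaj_wmaj (R : realType) (n : nat) (a b : nat -> R) :
  (forall i, 0 <= a i) -> (forall i, 0 <= b i) ->
  (forall i j, (i <= j < n)%N -> a j <= a i) ->
  (forall k, (k <= n)%N -> \prod_(l < k) a l <= \prod_(l < k) b l) ->
  forall k, (k <= n)%N -> \sum_(l < k) a l <= \sum_(l < k) b l.
Proof.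
move=> a0 b0 adec pab; elim=> [|k IHk] kn; first by rewrite !big_ord0.
(* If [a k] vanishes, the last term adds nothing on the left. Otherwise [a] is positive up to [k] by
   monotonicity, and so is [b], since a zero factor would annihilate the dominating product;
   logarithms then make sense. *)
have [ak|ak] := lerP (a k) 0.
  rewrite !big_ord_recr/= lerD ?IHk//; first exact: ltnW.
  exact: le_trans ak (b0 k).
have apos l : (l < k.+1)%N -> 0 < a l.
  by move=> lk; apply: lt_le_trans ak (adec _ _ _); rewrite -ltnS lk.
have bpos l : (l < k.+1)%N -> 0 < b l.
  move=> lk; rewrite lt0r b0 andbT; apply/eqP => bl.
  have := pab k.+1 kn; rewrite leNgt (bigD1 (Ordinal lk))//= bl mul0r.
  by rewrite prodr_gt0// => i _; apply: apos.
rewrite -subr_ge0 -sumrB.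
apply: (@le_trans _ _ (\sum_(l < k.+1) a l * ln (b l / a l))); last first.
  apply: ler_sum => l _; have al := apos l (ltn_ord l); have bl := bpos l (ltn_ord l).
  have := @le_ln1Dx R (b l / a l - 1); rewrite addrCA subrr addr0 => h.
  have {h} : ln (b l / a l) <= b l / a l - 1.
    by apply: h; rewrite ltrBrDr addNr divr_gt0.
  move=> /(ler_wpM2l (ltW al)) /le_trans; apply.
  by rewrite mulrBr mulr1 mulrCA divff ?mulr1// gt_eqF.
apply: (@abel_ge0 R a (fun l => ln (b l / a l)) k.+1) => [i _||m mk]; first exact: a0.
  by move=> i ik; rewrite adec// leqnSn (leq_trans ik).
have lk (l : 'I_m) : (l < k.+1)%N by exact: leq_trans mk.
have -> : \sum_(l < m) ln (b l / a l) =
    ln (\prod_(l < m) b l) - ln (\prod_(l < m) a l).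
  have lnprod (f : nat -> R) : (forall l : 'I_m, 0 < f l) ->
      ln (\prod_(l < m) f l) = \sum_(l < m) ln (f l).
    move=> f0; suff [] : 0 < \prod_(l < m) f l /\
      ln (\prod_(l < m) f l) = \sum_(l < m) ln (f l) by [].
    apply: (big_ind2 (fun x y => 0 < x /\ ln x = y)) => [|x1 x2 y1 y2|l _].
    - by rewrite ltr01 ln1.
    - by move=> [? <-] [? <-]; rewrite mulr_gt0// lnM.
    - by rewrite f0.
  rewrite !lnprod -?sumrB; [|by move=> l; apply: apos|by move=> l; apply: bpos].
  by apply: eq_bigr => l _; rewrite ln_div// posrE ?apos ?bpos.
rewrite subr_ge0 ler_ln ?posrE.
- exact/pab/(leq_trans mk).
- by apply: prodr_gt0 => l _; apply: apos.
- by apply: prodr_gt0 => l _; apply: bpos.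
Qed.

(** * Hölder's inequality for symmetric gauge functions *)

(** Young's inequality for the conjugate exponents [r / p] and [s / p], applied to [u^p / X^(p/r)]
    and [v^p / Y^(p/s)]. The bound is linear in [u^r] and [v^s], ready for the triangle inequality
    of a gauge. *)
Lemma young_scaled (R : realType) (u v p r s X Y : R) :
  0 <= u -> 0 <= v -> 0 < p -> 0 < r -> 0 < s -> p^-1 = r^-1 + s^-1 ->
  0 < X -> 0 < Y ->
  (u * v) `^ p <= X `^ (p / r) * Y `^ (p / s) *
    ((p / r) * (u `^ r / X) + (p / s) * (v `^ s / Y)).
Proof.
move=> u0 v0 p0 r0 s0 prs X0 Y0.
have prs1 : p / r + p / s = 1 by rewrite -mulrDr -prs divff// gt_eqF.
have := @conjugate_powR R ((u `^ p) / X `^ (p / r))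
  ((v `^ p) / Y `^ (p / s)) (r / p) (s / p).
rewrite !invf_div => /(_ _ _ _ _ prs1).
move=> /(_ (divr_ge0 (powR_ge0 _ _) (powR_ge0 _ _))).
move=> /(_ (divr_ge0 (powR_ge0 _ _) (powR_ge0 _ _))).
move=> /(_ (divr_gt0 r0 p0) (divr_gt0 s0 p0)).
have powRK z t : 0 < t -> (z `^ p) `^ (t / p) = z `^ t.
  by move=> t0; rewrite -powRrM mulrCA divff ?mulr1// gt_eqF.
have powRVK z t : 0 < z -> 0 < t -> ((z `^ (p / t))^-1) `^ (t / p) = z^-1.
  move=> z0 t0; rewrite -powRN -powRrM mulNr mulrA divfK ?gt_eqF//.
  by rewrite divff ?gt_eqF// powR_inv1 ?ltW.
rewrite mulf_div -powRM// ler_pdivrMr ?mulr_gt0 ?powR_gt0// => /le_trans; apply.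
rewrite !powRM ?invr_ge0 ?powR_ge0// !powRK// !powRVK//.
by rewrite [leRHS]mulrC ![p / _ * _]mulrC.
Qed.

(** With [X] and [Y] the gauges of the two rows on the right, [young_scaled] holds in each
    coordinate; monotonicity and the triangle inequality then leave the weights [p / r] and [p / s],
    whose sum is 1. *)
Lemma gauge_holder (R : realType) (n : nat) (Phi : 'rV[R]_n -> R)
    (x y : nat -> R) (p r s : R) : symmetric_gauge Phi ->
  (forall i, 0 <= x i) -> (forall i, 0 <= y i) ->
  0 < p -> 0 < r -> 0 < s -> p^-1 = r^-1 + s^-1 ->
  Phi (\row_(i < n) ((x i * y i) `^ p)) `^ p^-1 <=
  Phi (\row_(i < n) (x i `^ r)) `^ r^-1 * Phi (\row_(i < n) (y i `^ s)) `^ s^-1.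
Proof.
move=> gPhi x0 y0 p0 r0 s0 prs.
have scal (X Y : R) :
    (X `^ (p / r) * Y `^ (p / s)) `^ p^-1 = X `^ r^-1 * Y `^ s^-1.
  by rewrite powRM ?powR_ge0// -!powRrM ![p / _]mulrC !mulfK ?gt_eqF.
set X := Phi (\row_(i < n) (x i `^ r)); set Y := Phi (\row_(i < n) (y i `^ s)).
(* A vanishing gauge forces its row, hence all products [x i * y i], to vanish. This case is settled
   first because [X] and [Y] become denominators. *)
have row_gauge0 (z : nat -> R) t : t != 0 -> Phi (\row_(i < n) (z i `^ t)) = 0 ->
    forall i : 'I_n, z i = 0.
  move=> t0 /(gauge0_eq0 gPhi)/rowP h i; have := h i; rewrite !mxE.
  exact: powR_eq0_eq0.
have Phi00 : Phi 0 = 0 by rewrite -(scale0r 0) (gaugeZ gPhi) normr0 mul0r.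
have triv : (forall i : 'I_n, x i * y i = 0) ->
  Phi (\row_(i < n) ((x i * y i) `^ p)) `^ p^-1 <= X `^ r^-1 * Y `^ s^-1.
  move=> xy; suff -> : \row_(i < n) ((x i * y i) `^ p) = 0.
    by rewrite Phi00 powR0 ?invr_neq0 ?gt_eqF// mulr_ge0 ?powR_ge0.
  by apply/rowP => i; rewrite !mxE xy powR0// gt_eqF.
have [X0|X0] := eqVneq X 0.
  by apply: triv => i; rewrite (row_gauge0 _ _ _ X0) ?mul0r// gt_eqF.
have [Y0|Y0] := eqVneq Y 0.
  by apply: triv => i; rewrite (row_gauge0 _ _ _ Y0) ?mulr0// gt_eqF.
have {}X0 : 0 < X by rewrite lt0r X0 gauge_ge0.
have {}Y0 : 0 < Y by rewrite lt0r Y0 gauge_ge0.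
pose c := X `^ (p / r) * Y `^ (p / s).
have c0 : 0 < c by rewrite mulr_gt0// powR_gt0.
have prs1 : p / r + p / s = 1 by rewrite -mulrDr -prs divff// gt_eqF.
have step : Phi (\row_(i < n) ((x i * y i) `^ p)) <= c.
  pose z := (c * (p / r) / X) *: (\row_(i < n) (x i `^ r)) +
            (c * (p / s) / Y) *: (\row_(i < n) (y i `^ s)).
  apply: (@le_trans _ _ (Phi z)).
    apply: gauge_mono => // i; rewrite !mxE powR_ge0/=.
    apply: le_trans (young_scaled _ _ p0 r0 s0 prs X0 Y0) _ => //.
    have e (a b u v : R) : a * (b * (u / v)) = a * b / v * u.
      by rewrite [RHS]mulrAC !mulrA.
    by rewrite mulrDr !e.
  case: gPhi => -[_ _ gZ gD] _ _ _; apply: le_trans (gD _ _) _.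
  have k0 a b t : 0 < t -> 0 < a -> 0 < b -> 0 <= a * (p / t) / b.
    move=> t0 a0 b0; apply: divr_ge0 (ltW b0).
    exact: mulr_ge0 (ltW a0) (ltW (divr_gt0 p0 t0)).
  rewrite !gZ !ger0_norm ?k0//.
  by rewrite -/X -/Y !divfK ?gt_eqF// -mulrDr prs1 mulr1.
have := @ge0_ler_powR R p^-1; rewrite invr_ge0 (ltW p0) => /(_ isT).
move=> /(_ _ _ _ _ step); rewrite !nnegrE (gauge_ge0 gPhi) (ltW c0) => /(_ isT isT).
by rewrite /c scal.
Qed.

(** * Gram determinants and Horn's inequality *)

(** In the Leibniz formula the sums defining the entries of [A *m B] are multiplied out; for a fixed
    choice [f] of summation indices, the sum over permutations is a minor of [B], possibly with
    repeated rows. *)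
Lemma det_mulmx_ffun (R : comNzRingType) (k n : nat)
    (A : 'M[R]_(k, n)) (B : 'M[R]_(n, k)) :
  \det (A *m B) =
  \sum_(f : {ffun 'I_k -> 'I_n}) (\prod_j A j (f j)) * \det (rowsub f B).
Proof.
transitivity (\sum_(s : 'S_k) \sum_(f : {ffun 'I_k -> 'I_n})
   (-1) ^+ s * \prod_i (A i (f i) * B (f i) (s i))).
  apply: eq_bigr => s _; rewrite -big_distrr /=; congr (_ * _).
  rewrite -(bigA_distr_bigA (fun i j => A i j * B j (s i))).
  by apply: eq_bigr => i _; rewrite mxE.
rewrite exchange_big; apply: eq_bigr => f _.
rewrite [in RHS]/determinant big_distrr; apply: eq_bigr => s _.
rewrite big_split mulrCA; congr (_ * (_ * _)).
by apply: eq_bigr => i _; rewrite mxE.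
Qed.

(* The Cauchy-Binet formula, summed over all maps rather than over the
   increasing ones: each minor then occurs k! times. *)
Lemma Cauchy_Binet (R : comNzRingType) (k n : nat)
    (A : 'M[R]_(k, n)) (B : 'M[R]_(n, k)) :
  k`!%:R * \det (A *m B) =
  \sum_(f : {ffun 'I_k -> 'I_n}) \det (colsub f A) * \det (rowsub f B).
Proof.
transitivity (\sum_(s : 'S_k) \det (A *m B)).
  by rewrite sumr_const card_Sn mulr_natl.
transitivity (\sum_(s : 'S_k) \sum_(f : {ffun 'I_k -> 'I_n})
   (\prod_j A j (f (s j))) * ((-1) ^+ s * \det (rowsub f B))).
  apply: eq_bigr => s _; rewrite det_mulmx_ffun.
  (* Composing [f] with [s] permutes the rows of the minor of [B] and so produces the sign of [s];
     for fixed [f], summing over [s] then rebuilds the minor of [A]. *)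
  rewrite (reindex (fun f : {ffun 'I_k -> 'I_n} => [ffun j => f (s j)])) /=.
    apply: eq_bigr => f _; congr (_ * _).
      by apply: eq_bigr => j _; rewrite ffunE.
    rewrite -det_perm -det_mulmx -row_permE; congr (\det _).
    by apply/matrixP => i j; rewrite !mxE ffunE.
  exists (fun f : {ffun 'I_k -> 'I_n} => [ffun j => f ((s^-1)%g j)]) => f _;
    by apply/ffunP => j; rewrite !ffunE ?permK ?permKV.
rewrite exchange_big; apply: eq_bigr => f _.
rewrite [\det (colsub f A)]/determinant big_distrl; apply: eq_bigr => s _.
rewrite mulrCA mulrA; congr (_ * _ * _).
by apply: eq_bigr => j _; rewrite mxE.
Qed.

Lemma leq_nth_sorted_ltn (s : seq nat) i :
  sorted ltn s -> (i < size s)%N -> (i <= nth 0%N s i)%N.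
Proof.
move=> ss; elim: i => // i IHi si; apply: leq_ltn_trans (IHi (ltnW si)) _.
by apply: (sorted_ltn_nth ltn_trans) => //; rewrite inE// ltnW.
Qed.

(** The values of [f] are distinct, so once sorted the one in position [i] is at least [i], and [d]
    decreases. *)
Lemma prod_inj_le (R : numDomainType) (k n : nat) (d : nat -> R)
    (f : 'I_k -> 'I_n) :
  (forall i, 0 <= d i) -> (forall i j, (i <= j < n)%N -> d j <= d i) ->
  injective f -> \prod_(j < k) d (f j) <= \prod_(j < k) d j.
Proof.
move=> d0 ddec finj.
pose s := sort leq [seq val (f j) | j <- enum 'I_k].
have sz : size s = k by rewrite size_sort size_map size_enum_ord.
have ss : sorted ltn s.
  rewrite ltn_sorted_uniq_leq sort_uniq sort_sorted ?andbT; last exact: leq_total.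
  by rewrite map_inj_uniq ?enum_uniq// => i j /val_inj/finj.
have -> : \prod_(j < k) d (f j) = \prod_(x <- s) d x.
  rewrite (perm_big _ (permEl (perm_sort _ _))) big_map.
  by rewrite big_enum.
rewrite (big_nth 0%N) big_mkord sz; apply: ler_prod => i _; rewrite d0/=.
have ik : (i < size s)%N by rewrite sz.
apply: ddec; rewrite leq_nth_sorted_ltn//=.
have := mem_nth 0%N ik; rewrite mem_sort => /mapP[j _ ->]; exact: ltn_ord.
Qed.

Section Gram.
Variable C : numClosedFieldType.

Lemma adjmxM (m n p : nat) (A : 'M[C]_(m, n)) (B : 'M[C]_(n, p)) :
  (A *m B)^t* = B^t* *m A^t*.
Proof. by rewrite trmx_mul map_mxM. Qed.

(** By Cauchy-Binet both sides, times [k!], are sums over maps [f] of squared moduli of minors of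
    [Z], with weight [\prod_j d (f j)] on the left. Injective [f] are compared by [prod_inj_le]; for
    the others the minor is zero. *)
Lemma det_gram_diag_le (n k : nat) (d : nat -> C) (Z : 'M[C]_(n, k)) :
  (forall i, 0 <= d i) -> (forall i j, (i <= j < n)%N -> d j <= d i) ->
  \det (Z^t* *m diag_mx (\row_(i < n) d i) *m Z) <=
  (\prod_(j < k) d j) * \det (Z^t* *m Z).
Proof.
move=> d0 ddec; have k0 : 0 < k`!%:R :> C by rewrite ltr0n fact_gt0.
rewrite -(ler_pM2l k0) mulrCA !Cauchy_Binet mulr_sumr; apply: ler_sum => f _.
have -> : colsub f (Z^t* *m diag_mx (\row_(i < n) d i)) =
    colsub f (Z^t*) *m diag_mx (\row_j d (f j)).
    by apply/matrixP => i j; rewrite mul_mx_diag mxE mul_mx_diag !mxE.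
have -> : colsub f (Z^t*) = (rowsub f Z)^t*.
  by apply/matrixP => i j; rewrite !mxE.
rewrite det_mulmx det_diag det_map_mx det_tr mulrAC mulrC.
have [/injectiveP finj|/injectivePn[i [j ij fij]]] := boolP (injectiveb f).
  apply: ler_wpM2r; first by rewrite mulrC mul_conjC_ge0.
  under eq_bigr do rewrite mxE.
  exact: prod_inj_le.
rewrite (@determinant_alternate _ _ (rowsub f Z) _ _ ij) ?mulr0//.
by move=> l; rewrite !mxE fij.
Qed.

(** Indexing [d] by [nat] lets products over its first [k] entries be written without casts into
    ['I_n]. *)
Definition diagonalizes (n : nat) (d : nat -> C) (U H : 'M[C]_n) :=
  U \is unitarymx /\ H = U^t* *m diag_mx (\row_(i < n) d i) *m U.

Lemma det_gram_le (n k : nat) (d : nat -> C) (U H : 'M[C]_n) (Z : 'M[C]_(n, k)) :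
  (forall i, 0 <= d i) -> (forall i j, (i <= j < n)%N -> d j <= d i) ->
  diagonalizes d U H ->
  \det (Z^t* *m H *m Z) <= (\prod_(j < k) d j) * \det (Z^t* *m Z).
Proof.
move=> d0 ddec [Uu ->]; have := det_gram_diag_le (U *m Z) d0 ddec.
rewrite adjmxM !mulmxA.
have -> : Z^t* *m U^t* *m U *m Z = Z^t* *m Z.
  by rewrite -(mulmxA _ _ U) -invmx_unitary// mulVmx ?mulmx1// unitarymx_unit.
by [].
Qed.

(** Equality in [det_gram_le] is attained at the first [k] columns of [U^t*], which are orthonormal
    eigenvectors for the first [k] entries of [d]. *)
Lemma det_gram_eq (n k : nat) (d : nat -> C) (U H : 'M[C]_n) :
  (k <= n)%N -> diagonalizes d U H ->
  exists2 Z : 'M[C]_(n, k), Z^t* *m Z = 1%:M &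
    \det (Z^t* *m H *m Z) = \prod_(j < k) d j.
Proof.
move=> kn [Uu ->]; pose w := widen_ord kn.
have UU : U *m U^t* = 1%:M by apply/unitarymxP.
pose Z := colsub w (U^t*).
have ZE : Z^t* = rowsub w U.
  by rewrite -[in RHS](trmxCK U); apply/matrixP => i j; rewrite !mxE.
have ZU : Z^t* *m U^t* = rowsub w 1%:M by rewrite ZE mul_rowsub_mx UU.
have UZ : U *m Z = colsub w 1%:M by rewrite mulmx_colsub UU.
exists Z.
  rewrite ZE mul_rowsub_mx UZ; apply/matrixP => i j.
  by rewrite !mxE -val_eqE.
rewrite !mulmxA ZU -mulmxA UZ.
rewrite (_ : _ *m _ = diag_mx (\row_(j < k) d j)).
  by rewrite det_diag; apply: eq_bigr => j _; rewrite mxE.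
rewrite mul_rowsub_mx mul1mx mulmx_colsub mulmx1.
by apply/matrixP => i j; rewrite !mxE -!val_eqE.
Qed.

(* Horn's inequality for products of singular values, here in squared form. *)
Lemma horn_log_wmaj (n k : nat) (X Y U1 U2 U3 : 'M[C]_n) (d1 d2 d3 : nat -> C) :
  (forall i, 0 <= d1 i) -> (forall i j, (i <= j < n)%N -> d1 j <= d1 i) ->
  (forall i, 0 <= d2 i) -> (forall i j, (i <= j < n)%N -> d2 j <= d2 i) ->
  diagonalizes d1 U1 (X^t* *m X) -> diagonalizes d2 U2 (Y^t* *m Y) ->
  diagonalizes d3 U3 ((X *m Y)^t* *m (X *m Y)) -> (k <= n)%N ->
  \prod_(j < k) d3 j <= \prod_(j < k) d1 j * \prod_(j < k) d2 j.
Proof.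
move=> d1_0 d1dec d2_0 d2dec dX dY dXY kn.
have [Z ZZ <-] := det_gram_eq kn dXY.
(* Compressing the Gram matrix of [X *m Y] to [Z] amounts to compressing that of [X] to [Y *m Z],
   whose own Gram matrix is that of [Y] compressed to [Z]. *)
have -> : Z^t* *m ((X *m Y)^t* *m (X *m Y)) *m Z =
    (Y *m Z)^t* *m (X^t* *m X) *m (Y *m Z) by rewrite !adjmxM !mulmxA.
apply: le_trans (det_gram_le _ d1_0 d1dec dX) _.
apply: ler_wpM2l; first exact: prodr_ge0.
rewrite (_ : _ *m _ = Z^t* *m (Y^t* *m Y) *m Z); last by rewrite adjmxM !mulmxA.
by apply: le_trans (det_gram_le _ d2_0 d2dec dY) _; rewrite ZZ det1 mulr1.
Qed.

End Gram.

(** * Singular values *)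

Lemma char_poly_similar (F : fieldType) (n : nat) (V U D : 'M[F]_n) :
  V *m U = 1%:M -> char_poly (V *m D *m U) = char_poly D.
Proof.
move=> VU; rewrite /char_poly.
have -> : char_poly_mx (V *m D *m U) =
    map_mx polyC V *m char_poly_mx D *m map_mx polyC U.
  rewrite /char_poly_mx mulmxBr mulmxBl !map_mxM; congr (_ - _).
  by rewrite scalar_mxC -mulmxA -map_mxM VU map_mx1 mulmx1.
by rewrite !det_mulmx mulrAC -det_mulmx -map_mxM VU map_mx1 det1 mul1r.
Qed.

Lemma char_poly_diag (F : fieldType) (n : nat) (d : 'rV[F]_n) :
  char_poly (diag_mx d) = \prod_(x <- [seq d 0 j | j <- enum 'I_n]) ('X - x%:P).
Proof.
rewrite char_poly_trig ?diag_mx_is_trig// big_map big_enum.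
by apply: eq_bigr => i _; rewrite mxE eqxx.
Qed.

(** Both lists are the roots of the characteristic polynomial of [H]. This ties the chosen
    [spectral_diag] to any explicit unitary diagonalization. *)
Lemma spectral_diag_perm (C : numClosedFieldType) (n : nat) (d : 'rV[C]_n)
    (U H : 'M[C]_n) :
  U \is unitarymx -> H = U^t* *m diag_mx d *m U ->
  perm_eq [seq spectral_diag H 0 j | j <- enum 'I_n] [seq d 0 j | j <- enum 'I_n].
Proof.
move=> Uu HE; apply: prod_XsubC_eq; rewrite -!char_poly_diag.
have similar (V : 'M[C]_n) e : V \is unitarymx ->
    char_poly (invmx V *m diag_mx e *m V) = char_poly (diag_mx e).
  by move=> Vu; rewrite char_poly_similar// mulVmx// unitarymx_unit.
rewrite -(similar _ _ (spectral_unitarymx H)) -(similar _ _ Uu).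
rewrite (invmx_unitary Uu) -HE; congr char_poly; apply/esym/orthomx_spectralP.
by apply/orthomx_spectral_subproof; exists (U, d); rewrite /= ?invmx_unitary.
Qed.

Section SingularValues.
Variables (R : realType) (n : nat).
Implicit Types (H X U : 'M[R[i]]_n) (t : R).

Definition eigs H : seq R :=
  [seq complex.Re (spectral_diag H 0 j) | j <- enum 'I_n].

Lemma size_eigs H : size (eigs H) = n.
Proof. by rewrite size_map size_enum_ord. Qed.

Lemma eigs_perm (d : 'I_n -> R) U H :
  U \is unitarymx -> H = U^t* *m diag_mx (\row_i (d i)%:C%C) *m U ->
  perm_eq (eigs H) [seq d j | j <- enum 'I_n].
Proof.
move=> Uu HE; have := perm_map (@complex.Re R) (spectral_diag_perm Uu HE).
rewrite -!(map_comp _ _ (enum 'I_n)) => h; apply: perm_trans h _.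
by rewrite (@eq_map _ _ (_ \o _) d) => [|i]; rewrite /= ?mxE.
Qed.

Lemma mxfunE f H : mxfun f H = (spectralmx H)^t* *m
  diag_mx (\row_i (f (complex.Re (spectral_diag H 0 i)))%:C%C) *m spectralmx H.
Proof.
rewrite /mxfun (invmx_unitary (spectral_unitarymx H)).
set e := map_mx _ (spectral_diag H); suff -> : e = \row_i (f (complex.Re (spectral_diag H 0 i)))%:C%C by [].
by apply/rowP => i; rewrite !mxE.
Qed.

Lemma eigs_mxfun f H : perm_eq (eigs (mxfun f H)) [seq f x | x <- eigs H].
Proof.
rewrite -(map_comp _ _ (enum 'I_n)).
exact: eigs_perm (spectral_unitarymx H) (mxfunE f H).
Qed.

Lemma gram_spectral X : X^t* *m X = (spectralmx (X^t* *m X))^t* *m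
  diag_mx (spectral_diag (X^t* *m X)) *m spectralmx (X^t* *m X).
Proof.
have /orthomx_spectralP : X^t* *m X \is normalmx by apply/normalmxP; rewrite !adjmxM trmxCK.
by rewrite (invmx_unitary (spectral_unitarymx (X^t* *m X))).
Qed.

(** For [U] the spectral matrix, these eigenvalues are the squared norms of the columns of
    [X *m U^t*]. *)
Lemma spectral_gram_ge0 X i : 0 <= spectral_diag (X^t* *m X) 0 i.
Proof.
have Uu := spectral_unitarymx (X^t* *m X); have := gram_spectral X.
move: (spectralmx _) (spectral_diag _) Uu => U d Uu XE.
have /matrixP/(_ i i) : (X *m U^t*)^t* *m (X *m U^t*) = diag_mx d.
  rewrite adjmxM trmxCK -mulmxA (mulmxA _ X) XE -!mulmxA (unitarymxP Uu) mulmx1.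
  by rewrite mulmxA (unitarymxP Uu) mul1mx.
rewrite !mxE eqxx mulr1n => <-; apply: sumr_ge0 => l _.
by rewrite mxE mxE mulrC mul_conjC_ge0.
Qed.

Lemma eigs_absmx X :
  perm_eq (eigs (absmx X)) [seq Num.sqrt x | x <- eigs (X^t* *m X)].
Proof. exact: eigs_mxfun. Qed.

(** Reads singular values off any unitary diagonalization of the Gram matrix, without computing
    [absmx X]. *)
Lemma eigs_absmx_diag (d : 'I_n -> R) U X : (forall i, 0 <= d i) ->
  U \is unitarymx ->
  X^t* *m X = U^t* *m diag_mx (\row_i ((d i) ^+ 2)%:C%C) *m U ->
  perm_eq (eigs (absmx X)) [seq d j | j <- enum 'I_n].
Proof.
move=> d0 Uu XE; apply: perm_trans (eigs_absmx X) _.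
apply: perm_trans (perm_map _ (eigs_perm Uu XE)) _.
rewrite -(map_comp _ _ (enum 'I_n)); under eq_map do rewrite /= sqrtr_sqr ger0_norm//.
by [].
Qed.

(** The default 0 past the last singular value keeps the sequence nonnegative at every index, as the
    majorization lemmas expect. *)
Definition sv X : nat -> R := nth 0 (sort >=%R (eigs (absmx X))).

Lemma singular_valuesE X : singular_values X = \row_i sv X i.
Proof. by []. Qed.

Lemma eigs_absmx_ge0 X x : x \in eigs (absmx X) -> 0 <= x.
Proof. by rewrite (perm_mem (eigs_absmx X)) => /mapP[y _ ->]; apply: sqrtr_ge0. Qed.

Lemma sv_ge0 X i : 0 <= sv X i.
Proof.
rewrite /sv; have [im|im] := ltnP i (size (sort >=%R (eigs (absmx X)))).
  by apply: (@eigs_absmx_ge0 X); rewrite -(mem_sort >=%R) mem_nth.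
by rewrite nth_default.
Qed.

Lemma sv_dec X i j : (i <= j < n)%N -> sv X j <= sv X i.
Proof.
move=> /andP[ij jn]; apply: (sorted_leq_nth (leT := >=%R)) => //.
- by move=> x y z; apply: ge_trans.
- by move=> x /=.
- exact: sort_sorted ge_total _.
- by rewrite inE size_sort size_eigs (leq_ltn_trans ij).
- by rewrite inE size_sort size_eigs.
Qed.

Lemma eigs_absmx_absmx_pow X t :
  perm_eq (eigs (absmx (absmx_pow X t))) [seq x `^ t | x <- eigs (absmx X)].
Proof.
have XE : absmx_pow X t = _ := mxfunE (fun a => a `^ t) (absmx X).
have Uu := spectral_unitarymx (absmx X).
move: (spectralmx _) Uu XE => U Uu XE.
rewrite -(map_comp _ _ (enum 'I_n)).
apply: (eigs_absmx_diag _ Uu) => [i|]; first exact: powR_ge0.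
rewrite {}XE !adjmxM trmxCK tr_diag_mx map_diag_mx !mulmxA.
congr (_ *m _); rewrite -(mulmxA _ U) (unitarymxP Uu) mulmx1 -mulmxA; congr (_ *m _).
rewrite mulmx_diag; congr diag_mx; apply/rowP => i; rewrite !mxE.
by rewrite /= conj_Creal ?rmorphM//; apply/complex_realP; eexists.
Qed.

Lemma perm_eq_nth (s s' : seq R) : perm_eq s s' -> size s' = n ->
  exists p : 'S_n, forall i : 'I_n, nth 0 s i = nth 0 s' (p i).
Proof.
move=> ss' sz; have : perm_eq s (Tuple (introT eqP sz)) by [].
move=> /tuple_permP[p ->]; exists p => i.
by rewrite -[LHS](tnth_nth 0 [tuple _ | i < n]) tnth_mktuple (tnth_nth 0).
Qed.

Lemma adj_perm_mx (p : 'S_n) : (perm_mx p : 'M[R[i]]_n)^t* = perm_mx p^-1%g.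
Proof. by rewrite tr_perm_mx map_perm_mx. Qed.

(** A permutation matrix reorders the rows of the spectral matrix, so that the squared singular
    values appear in decreasing order on the diagonal. *)
Lemma sv_diagonalizes X : exists U,
  diagonalizes (fun i => ((sv X i) ^+ 2)%:C%C) U (X^t* *m X).
Proof.
have [||p hp] := @perm_eq_nth (sort >=%R (eigs (absmx X)))
    [seq Num.sqrt x | x <- eigs (X^t* *m X)].
- by rewrite perm_sort eigs_absmx.
- by rewrite size_map size_eigs.
have svE (i : 'I_n) : sv X i ^+ 2 = complex.Re (spectral_diag (X^t* *m X) 0 (p i)).
  rewrite /sv hp (nth_map 0) ?size_eigs// (nth_map i) ?size_enum_ord//.
  rewrite nth_ord_enum sqr_sqrtr//.
  by have := spectral_gram_ge0 X (p i); rewrite lecE => /andP[].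
have XE := gram_spectral X; have Uu := spectral_unitarymx (X^t* *m X).
have d0 := spectral_gram_ge0 X.
move: (spectralmx _) (spectral_diag _) Uu d0 XE svE => V d Vu d0 XE svE.
exists (perm_mx p *m V); split.
  apply: mul_unitarymx Vu; apply/unitarymxP.
  by rewrite adj_perm_mx -perm_mxM mulgV perm_mx1.
rewrite adjmxM adj_perm_mx {}XE.
have -> : diag_mx (\row_(i < n) ((sv X i) ^+ 2)%:C%C) =
    perm_mx p *m diag_mx d *m perm_mx p^-1%g.
  rewrite -mulmxA -col_permE -row_permE; apply/matrixP => i j.
  rewrite !mxE (inj_eq perm_inj); congr (_ *+ _).
  by rewrite svE RRe_real// ger0_real.
have PP : perm_mx p^-1%g *m perm_mx p = 1%:M :> 'M[R[i]]_n.
  by rewrite -perm_mxM mulVg perm_mx1.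
by rewrite !mulmxA -(mulmxA _ _ (perm_mx p)) PP mulmx1 -(mulmxA _ _ (perm_mx p)) PP mulmx1.
Qed.

Lemma sv_neq0 X (i : 'I_n) : X \in unitmx -> sv X i != 0.
Proof.
move=> Xu; have [U [_ XE]] := sv_diagonalizes X.
have : X^t* *m X \in unitmx by rewrite unitmx_mul Xu map_unitmx unitmx_tr Xu.
rewrite XE !unitmx_mul => /andP[/andP[_ +] _].
rewrite unitmxE det_diag unitfE => /prodf_neq0/(_ i isT).
by rewrite mxE fmorph_eq0 expf_eq0.
Qed.

Lemma eigs_absmx_invmx X : X \in unitmx ->
  perm_eq (eigs (absmx (invmx X))) [seq x^-1 | x <- eigs (absmx X)].
Proof.
move=> Xu; have [U [Uu XE]] := sv_diagonalizes X.
have eigsE : perm_eq [seq (sv X j)^-1 | j : 'I_n <- enum 'I_n]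
    [seq x^-1 | x <- eigs (absmx X)].
  rewrite (map_comp (fun x => x^-1) (fun j : 'I_n => sv X j)) perm_map//.
  rewrite (map_comp (sv X) (@nat_of_ord n)) val_enum_ord /sv.
  rewrite map_nth_iota0 ?size_sort ?size_eigs// take_oversize ?size_sort ?size_eigs//.
  by rewrite perm_sort.
apply: perm_trans eigsE.
have UU : U^t* *m U = 1%:M by rewrite -invmx_unitary// mulVmx// unitarymx_unit.
have XX : (invmx X)^t* *m X^t* = 1%:M by rewrite -adjmxM mulmxV// trmx1 map_mx1.
pose S := diag_mx (\row_(i < n) (sv X i)%:C%C).
have SS : S *m S = diag_mx (\row_(i < n) ((sv X i) ^+ 2)%:C%C).
  by rewrite mulmx_diag; congr diag_mx; apply/rowP => i; rewrite !mxE -rmorphM.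
have Sadj : S^t* = S.
  rewrite tr_diag_mx map_diag_mx; congr diag_mx; apply/rowP => i; rewrite !mxE.
  by rewrite /= conj_Creal//; apply/complex_realP; eexists.
(* S U X^-1 is unitary, because S^2 = U X^* X U^*, and it diagonalizes the
   Gram matrix of X^-1. *)
apply: (@eigs_absmx_diag _ (S *m U *m invmx X)).
- by move=> i; rewrite invr_ge0 sv_ge0.
- rewrite -trmxC_unitary; apply/unitarymxP; rewrite trmxCK !adjmxM Sadj.
  rewrite !mulmxA -(mulmxA _ S S) SS -(mulmxA _ (U^t*)) -(mulmxA _ (U^t* *m _)) -XE.
  by rewrite !mulmxA XX mul1mx mulmxV.
pose D := diag_mx (\row_(i < n) (((sv X i)^-1) ^+ 2)%:C%C).
have SDS : S *m D *m S = 1%:M.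
  rewrite !mulmx_diag -diag_const_mx; congr diag_mx; apply/rowP => i.
  rewrite !mxE -!rmorphM/= -[RHS](rmorph1 (@real_complex R)); congr (_%:C%C).
  by field; apply: sv_neq0.
rewrite -/D; move: S D {SS} Sadj SDS => S D Sadj SDS.
(* The identity [S *m D *m S] is inserted in the middle, so that the factors regroup around [D]. *)
transitivity ((invmx X)^t* *m (U^t* *m (S *m D *m S) *m U) *m invmx X).
  by rewrite SDS mulmx1 UU mulmx1.
by rewrite !adjmxM Sadj !mulmxA.
Qed.

Variable Phi : 'rV[R]_n -> R.
Hypothesis gPhi : symmetric_gauge Phi.

Lemma gauge_perm_eq (s s' : seq R) : perm_eq s s' -> size s' = n ->
  Phi (\row_i nth 0 s i) = Phi (\row_i nth 0 s' i).
Proof.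
move=> ss' /(perm_eq_nth ss')[p hp].
case: gPhi => _ hperm _ _; rewrite -(hperm p (\row_i nth 0 s' i)); congr Phi.
by apply/rowP => i; rewrite !mxE hp.
Qed.

(** Permutation invariance makes sorting invisible to [Phi], so eigenvalue lists may be used in any
    order. *)
Lemma gauge_sv_perm X (s : seq R) (f : R -> R) : perm_eq (eigs (absmx X)) s ->
  Phi (\row_i f (sv X i)) = Phi (\row_i nth 0 (map f s) i).
Proof.
move=> Xs; have szs : size s = n by rewrite -(perm_size Xs) size_eigs.
rewrite -(@gauge_perm_eq (map f (sort >=%R (eigs (absmx X))))) ?size_map//.
  congr Phi; apply/rowP => i.
  by rewrite !mxE (nth_map 0)// size_sort size_eigs.
by rewrite perm_map// perm_sort.
Qed.

Lemma gauge_absmx_pow X t :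
  Phi (singular_values (absmx_pow X t)) = Phi (\row_i sv X i `^ t).
Proof.
rewrite singular_valuesE (gauge_sv_perm (fun a => a `^ t) (perm_refl _)).
rewrite (gauge_sv_perm id (eigs_absmx_absmx_pow X t)).
by rewrite map_id.
Qed.

End SingularValues.

(** * Singular values of products and inverses, and the final inequality *)

Lemma prod_powR (R : realType) (a : nat -> R) (t : R) (k : nat) :
  (forall i, 0 <= a i) -> \prod_(l < k) a l `^ t = (\prod_(l < k) a l) `^ t.
Proof.
move=> a0; elim: k => [|k IHk]; first by rewrite !big_ord0 powR1.
by rewrite !big_ord_recr/= IHk powRM// prodr_ge0.
Qed.

Lemma sv_mul_log_wmaj (R : realType) (n k : nat) (X Y : 'M[R[i]]_n) :
  (k <= n)%N ->
  \prod_(j < k) sv (X *m Y) j <= \prod_(j < k) (sv X j * sv Y j).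
Proof.
move=> kn; have [U1 dX] := sv_diagonalizes X; have [U2 dY] := sv_diagonalizes Y.
have [U3 dXY] := sv_diagonalizes (X *m Y).
have d0 (Z : 'M[R[i]]_n) i : 0 <= ((sv Z i) ^+ 2)%:C%C.
  by rewrite ler0c sqr_ge0.
have ddec (Z : 'M[R[i]]_n) i j : (i <= j < n)%N ->
    ((sv Z j) ^+ 2)%:C%C <= ((sv Z i) ^+ 2)%:C%C.
  by move=> ij; rewrite lecR ler_sqr ?nnegrE ?sv_ge0// sv_dec.
(* Brings Horn's inequality back from squares in [R[i]] to the real numbers themselves. *)
have sqr_prod_le (x y z : nat -> R) :
    (forall i, 0 <= x i) -> (forall i, 0 <= y i) -> (forall i, 0 <= z i) ->
    \prod_(j < k) ((z j) ^+ 2)%:C%C <=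
      \prod_(j < k) ((x j) ^+ 2)%:C%C * \prod_(j < k) ((y j) ^+ 2)%:C%C :> R[i] ->
    \prod_(j < k) z j <= \prod_(j < k) (x j * y j).
  move=> x0 y0 z0; rewrite -!(rmorph_prod (real_complex R)).
  rewrite -(rmorphM (real_complex R)) lecR -big_split => h; rewrite -ler_sqr.
  - by rewrite -!prodrXl; under [leRHS]eq_bigr do rewrite exprMn.
  - by rewrite nnegrE prodr_ge0.
  - by rewrite nnegrE prodr_ge0// => i _; rewrite mulr_ge0.
apply: sqr_prod_le; [exact: sv_ge0..|].
exact: horn_log_wmaj (d0 X) (@ddec X) (d0 Y) (@ddec Y) dX dY dXY kn.
Qed.

(** Horn's inequality raised to the power [t] is a log-majorization; it gives weak majorization,
    hence Ky Fan dominance. *)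
Lemma gauge_sv_mul_le (R : realType) (n : nat) (Phi : 'rV[R]_n -> R)
    (X Y : 'M[R[i]]_n) (t : R) : symmetric_gauge Phi -> 0 < t ->
  Phi (\row_(i < n) sv (X *m Y) i `^ t) <=
  Phi (\row_(i < n) (sv X i * sv Y i) `^ t).
Proof.
move=> gPhi t0; pose a i := sv (X *m Y) i `^ t.
have powR_le u v : 0 <= u -> u <= v -> u `^ t <= v `^ t.
  by move=> u0 uv; apply: (ge0_ler_powR (ltW t0)) => //; rewrite nnegrE ?(le_trans u0).
have adec i j : (i <= j < n)%N -> a j <= a i.
  by move=> ij; rewrite powR_le ?sv_ge0 ?sv_dec.
have xy0 i : 0 <= sv X i * sv Y i by rewrite mulr_ge0 ?sv_ge0.
pose b i := (sv X i * sv Y i) `^ t.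
apply: (gauge_wmaj gPhi (b := b) adec) => [i|]; first exact: powR_ge0.
apply: (log_wmaj_wmaj _ _ adec) => [i|i|k kn].
- exact: powR_ge0.
- exact: powR_ge0.
rewrite (prod_powR _ _ (sv_ge0 (X *m Y))) (prod_powR _ _ xy0).
rewrite powR_le ?sv_mul_log_wmaj//.
by apply: prodr_ge0 => l _; exact: sv_ge0.
Qed.

(** Inversion reverses the order of the singular values, which [Phi] does not see, and the two sign
    changes in the exponent cancel. *)
Lemma gauge_sv_invmx (R : realType) (n : nat) (Phi : 'rV[R]_n -> R)
    (X : 'M[R[i]]_n) (t : R) : symmetric_gauge Phi -> X \in unitmx ->
  Phi (\row_(i < n) sv (invmx X) i `^ (- t)) = Phi (\row_(i < n) sv X i `^ t).
Proof.
move=> gPhi Xu.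
apply: etrans (gauge_sv_perm gPhi (fun a => a `^ (- t)) (eigs_absmx_invmx Xu)) _.
apply/esym; apply: etrans (gauge_sv_perm gPhi (fun a => a `^ t) (perm_refl _)) _.
congr Phi; apply/rowP => i; rewrite !mxE -[in RHS]map_comp; congr (_`_i).
apply/eq_in_map => x /eigs_absmx_ge0 x0 /=.
by rewrite -powR_inv1// -powRrM mulN1r opprK.
Qed.

Lemma powR_ndiv_le (R : realType) (x y y' z t : R) :
  y' = y -> 0 < y -> x <= z * y' `^ (- t)^-1 -> x * y `^ t^-1 <= z.
Proof. by move=> -> y0; rewrite invrN powRN ler_pdivlMr ?powR_gt0. Qed.

Theorem theorem2p2 (R : realType) (n : nat) (N : 'M[R[i]]_n -> R)
    (A B : 'M[R[i]]_n) (r p q : R) :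
  (0 < n)%N -> symmetric_norm N -> B \in unitmx ->
  0 < r -> 0 < p -> q < 0 -> r^-1 = p^-1 + q^-1 ->
  powR (N (absmx_pow (A *m B) r)) r^-1 >=
  powR (N (absmx_pow A p)) p^-1 * powR (N (absmx_pow B q)) q^-1.
Proof.
move=> n0 [_ [Phi gPhi NE]] Bu r0 p0 q0 rpq.
have NPE X t := etrans (NE (absmx_pow X t)) (gauge_absmx_pow gPhi X t).
suff : Phi (\row_i sv A i `^ p) `^ p^-1 * Phi (\row_i sv B i `^ q) `^ q^-1 <=
    Phi (\row_i sv (A *m B) i `^ r) `^ r^-1.
  by apply: etrans; congr (_ `^ _ * _ `^ _ <= _ `^ _); exact: NPE.
(* Positivity allows division by this gauge: [n0] provides a coordinate, and its entry is nonzero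
   because [B] is invertible. *)
have PB0 : 0 < Phi (\row_i sv B i `^ q).
  rewrite lt0r (gauge_ge0 gPhi) andbT; apply/eqP => /(gauge0_eq0 gPhi)/rowP.
  move=> /(_ (Ordinal n0)); rewrite !mxE => /eqP; rewrite powR_eq0.
  by rewrite (negPf (sv_neq0 _ Bu)).
have s0 : 0 < - q by rewrite oppr_gt0.
have prs : p^-1 = r^-1 + (- q)^-1 by rewrite rpq invrN addrK.
apply: powR_ndiv_le (gauge_sv_invmx q gPhi Bu) PB0 _.
(* Hölder pairs the singular values of [A *m B] with those of [invmx B]; the product of these two
   matrices is [A]. *)
apply: le_trans (gauge_holder gPhi (sv_ge0 (A *m B)) (sv_ge0 (invmx B)) p0 r0 s0 prs).
have := gauge_sv_mul_le (A *m B) (invmx B) gPhi p0; rewrite (mulmxK Bu).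
by apply: ge0_ler_powR; rewrite ?nnegrE ?invr_ge0 ?(ltW p0) ?(gauge_ge0 gPhi).
Qed.
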